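(* Let $S$ be a finite semigroup. For every nonempty word $w\in S^*$ there exists a summary of $w$ whose result is $\varphi_S(w)$ and whose height is at most $$\mathrm{L}(S)\,\bigl(\log_2(|S|)+2\log_2(R_S(3))+4\bigr),$$ where $\mathrm{L}(S)$ is the regular $\mathcal J$-length of $S$ and $R_S$ is the Ramsey function of $S$.
   Context: $\varphi_S$ evaluates a nonempty word over $S$: $\varphi_S(x_0\cdots x_k)=x_0\cdot x_1\cdots x_k\in S$. $\mathcal E(S)$ is the set of idempotents of $S$ (elements with $e\cdot e=e$). $S^{\mathbf 1}$ is $S$ with a neutral element adjoined. Write $x\le_{\mathcal J}y$ if $x=ayb$ for some $a,b\in S^{\mathbf 1}$, and $x<_{\mathcal J}y$ if $x\le_{\mathcal J}y$ and not $y\le_{\mathcal J}x$. The regular $\mathcal J$-length of $S$ is $\mathrm L(S)=\sup\{k\in\mathbb N : \exists e_1<_{\mathcal J}\cdots<_{\mathcal J}e_k\in\mathcal E(S)\}$. The Ramsey function $R_S:\mathbb N\to\mathbb N$: $R_S(k)$ is the minimal $N$ such that every word in $S^*$ of length $N$ contains an infix of the form $u_1\cdots u_k$ (nonempty words $u_i$) with $\varphi_S(u_1)=\cdots=\varphi_S(u_k)=e$ for some $e\in\mathcal E(S)$. A summary of a word $w\in S^*$ is an ordered binary tree with nodes labeled in $S\times S^*$, with three types of nodes: (1) a leaf has no children and has label $(x,x)$ for some $x\in S$ (the second component is the one-letter word $x$); (2) a product node labeled $(x,w)$ has two children labeled $(y_1,u_1)$ and $(y_2,u_2)$ with $y_1\cdot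 y_2=x$ and $u_1u_2=w$; (3) an idempotent node labeled $(e,w)$ has two children labeled $(e,u_1)$ and $(e,u_2)$ such that $w=u_1w'u_2$, $e\in\mathcal E(S)$ and $\varphi_S(u_1)=\varphi_S(u_2)=\varphi_S(w')=e$ (with $w'$ nonempty). The root is labeled $(x,w)$ for some $x\in S$, called the result of the summary. The height of a tree consisting of a single leaf is $0$. *)

(* Defs.v *)
From HB Require Import structures.
From mathcomp Require Import all_boot all_order all_algebra.
From mathcomp Require Import all_classical all_reals all_analysis.

Set Implicit Arguments.
Unset Strict Implicit.
Unset Printing Implicit Defensive.

Import Order.TTheory GRing.Theory Num.Theory.

#[short(type="finSemigroupType")]
HB.structure Definition FinSemigroup := {S of Semigroup S & Finite S}.

Lemma count_pigeonhole (T : Type) (C : finType) (f : T -> C) (s : seq T) n :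
  #|C| * n < size s -> exists a, n < count (fun y => f y == a) s.
Proof.
move=> ltns.
have [/existsP[a]|] := boolP [exists a, n < count (fun y => f y == a) s].
  by exists a.
rewrite negb_exists => /forallP h; exfalso; move: ltns; apply/negP; rewrite -leqNgt.
have -> : size s = \sum_a count (fun y => f y == a) s.
  elim: s {h} => [|y s IH] /=; first by rewrite big1.
  rewrite big_split /= -IH (bigD1 (f y)) //= eqxx big1 ?addn0 ?add1n // => a /negPf.
  by rewrite eq_sym => ->.
rewrite -sum_nat_const; apply: leq_sum => a _; by rewrite leqNgt h.
Qed.

Lemma ramsey_prehomogeneous (C : finType) (a0 : C) m :
  exists N, forall (c : nat -> nat -> C) (s : seq nat), uniq s -> N <= size s ->
    exists t d, [/\ subseq t s, size t = m
                  & pairwise (fun i j => c i j == d i) t].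
Proof.
elim: m => [|m [N IH]].
  by exists 0 => c s _ _; exists [::], (fun=> a0); split; rewrite ?sub0seq.
exists (#|C| * N).+2 => c [//|x s] /= /andP[xs us] szs.
have [a ca] := @count_pigeonhole _ C (c x) s N szs.
have [|t [d [tf szt pt]]] := IH c _ (filter_uniq (fun y => c x y == a) us).
  by rewrite size_filter ltnW.
have [ft ts] : all (fun y => c x y == a) t /\ subseq t s.
  split; last exact: subseq_trans tf (filter_subseq _ _).
  by apply/allP => y /(mem_subseq tf); rewrite mem_filter => /andP[].
have xt : x \notin t by apply: contra xs; exact: mem_subseq ts x.
exists (x :: t), (fun i => if i == x then a else d i); split => /=.
- by rewrite eqxx.
- by rewrite szt.
- rewrite eqxx ft /=; apply: (sub_in_pairwise (P := mem t)) pt; last exact/allP.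
  move=> i j it _ /eqP ->; case: (i =P x) => // ix.
  by case/negP: xt; rewrite -ix.
Qed.

Lemma ramsey_homogeneous (C : finType) (a0 : C) m :
  exists N, forall (c : nat -> nat -> C) (s : seq nat), uniq s -> N <= size s ->
    exists t a, [/\ subseq t s, m < size t & pairwise (fun i j => c i j == a) t].
Proof.
have [N HN] := ramsey_prehomogeneous a0 (#|C| * m).+1.
exists N => c s us szs; have [t [d [ts szt pt]]] := HN c s us szs.
have [|a ca] := @count_pigeonhole _ C d t m; first by rewrite szt.
exists [seq y <- t | d y == a], a; split.
- exact: subseq_trans (filter_subseq _ _) ts.
- by rewrite size_filter.
- have: pairwise (fun i j => c i j == d i) [seq y <- t | d y == a].
    exact: pairwise_filter.
  apply: (sub_in_pairwise (P := fun y => d y == a)); last exact: filter_all.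
  by move=> i j /= /eqP <-.
Qed.

Lemma flatten_factors (T : Type) (w : seq T) x (t : seq nat) : path ltn x t ->
  flatten (pairmap (fun i j => take (j - i) (drop i w)) x t)
    = take (last x t - x) (drop x w).
Proof.
elim: t x => [|y t IH] x /=; first by rewrite subnn take0.
move=> /andP[xy pt]; rewrite IH //.
have yl : y <= last y t.
  have := order_path_min ltn_trans pt.
  by case: (t) => [//|z r] /allP /(_ (last z r) (mem_last _ _)) /ltnW.
have -> : last y t - x = (y - x) + (last y t - y) by rewrite addnC addnBA ?subnK ?(ltnW xy).
by rewrite takeD drop_drop subnK // ltnW.
Qed.

Section Semigroup.
Variable S : finSemigroupType.
Implicit Types (x y e : S) (u v w : seq S) (us : seq (seq S)).

(* [phi] is undefined exactly on the empty word, so [phi w = Some x] entails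
   that [w] is nonempty. *)
Definition phi w : option S :=
  if w is x0 :: w' then Some (foldl (fun x y => x * y)%g x0 w') else None.

Definition idem : {set S} := [set e | (e * e)%g == e].

(* The product of S^1, where S^1 is [option S] with adjoined neutral element
   [None]. *)
Definition mul1 (a b : option S) : option S :=
  match a, b with
  | None, _ => b
  | _, None => a
  | Some x, Some y => Some (x * y)%g
  end.

Definition leJ x y : bool :=
  [exists a : option S, exists b : option S,
    Some x == mul1 (mul1 a (Some y)) b].

Definition ltJ x y : bool := leJ x y && ~~ leJ y x.

Definition has_chain (k : nat) : bool :=
  [exists e : k.-tuple S, all (mem idem) e && sorted ltJ e].

Lemma mul1A : associative mul1.
Proof. by move=> [x|] [y|] [z|] //=; rewrite mulgA. Qed.

Lemma phi_cat u v : phi (u ++ v) = mul1 (phi u) (phi v).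
Proof.
case: u => [|x u] /=; first by case: (phi v).
rewrite foldl_cat; case: v => [//|y v] /=; congr Some.
by elim: v y => [//|z v IH] y /=; rewrite -mulgA IH.
Qed.

Lemma leJ_trans : transitive leJ.
Proof.
move=> y x z /existsP[a /existsP[b /eqP xE]] /existsP[c /existsP[d /eqP yE]].
apply/existsP; exists (mul1 a c); apply/existsP; exists (mul1 d b).
by rewrite xE yE !mul1A.
Qed.

Lemma ltJ_trans : transitive ltJ.
Proof.
move=> y x z /andP[xy nyx] /andP[yz nzy]; rewrite /ltJ (leJ_trans xy yz) /=.
by apply: contra nzy => zx; exact: leJ_trans zx xy.
Qed.

Lemma has_chain0 : exists k, has_chain k.
Proof. by exists 0; apply/existsP; exists [tuple]. Qed.

Lemma has_chain_le k : has_chain k -> k <= #|S|.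
Proof.
move=> /existsP[e /andP[_ se]]; rewrite -(size_tuple e).
have /card_uniqP <- : uniq e.
  by apply: (sorted_uniq ltJ_trans) se => x; rewrite /ltJ andbN.
exact: max_card.
Qed.

Definition regJlength : nat := ex_maxn has_chain0 has_chain_le.

Definition has_ramsey_infix (k : nat) w : Prop :=
  exists us e, [/\ size us = k, infix (flatten us) w, e \in idem
                 & all (fun u => phi u == Some e) us].

Definition ramsey_bound (k N : nat) : Prop :=
  forall w, size w = N -> has_ramsey_infix k w.

Lemma ramsey_bound_ex (k : nat) : exists N, `[< ramsey_bound k N >].
Proof.
have [N HN] := @ramsey_homogeneous (option S) None (maxn k 2).
exists N; apply/asboolP => w szw.
pose f i j := take (j - i) (drop i w); pose c i j := phi (f i j).
have [||t [a [ts szt pt]]] := HN c (iota 0 N.+1); rewrite ?iota_uniq ?size_iota //.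
have st : sorted ltn t.
  exact: (subseq_sorted ltn_trans ts (iota_ltn_sorted _ _)).
have tN i : i \in t -> i <= N by move/(mem_subseq ts); rewrite mem_iota ltnS.
have kt : k < size t by apply: leq_ltn_trans szt; rewrite leq_maxl.
have : 2 < size t by apply: leq_ltn_trans szt; rewrite leq_maxr.
case: t => [|i0 t] // in ts szt pt st tN kt *.
case tE : t => [|i1 [|i2 t']] // _.
have i01 : i0 < i1 by move: st; rewrite tE /= => /andP[].
have c01 : c i0 i1 = a by move: pt; rewrite tE /= => /andP[/andP[/eqP]].
have c02 : c i0 i2 = a by move: pt; rewrite tE /= => /and3P[/and3P[_ /eqP]].
have c12 : c i1 i2 = a by move: pt; rewrite tE /= => /and3P[_ /andP[/eqP]].
have aa : mul1 a a = a.
  have /(flatten_factors w) /= : path ltn i0 [:: i1; i2].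
    by move: st; rewrite tE /= => /and3P[-> ->].
  by rewrite cats0 => /(congr1 phi); rewrite phi_cat -/(c i0 i1) -/(c i1 i2) -/(c i0 i2) c01 c12 c02.
have [e aE] : exists e, a = Some e.
  case: a c01 {pt c02 c12 aa} => [e _|]; first by exists e.
  have: 0 < size (f i0 i1).
    have i1N : i1 <= N by apply: tN; rewrite tE !inE eqxx orbT.
    have ? : i1 - i0 <= size (drop i0 w) by rewrite size_drop szw leq_sub2r.
    by rewrite size_takel // subn_gt0.
  by rewrite /c; case: (f i0 i1).
have {tE c01 c02 c12 i01} paths : path ltn i0 (take k t) by apply: take_path.
exists (pairmap f i0 (take k t)), e; split.
- by rewrite size_pairmap size_takel.
- rewrite flatten_factors //; set x := i0; set n := (_ - _).
  by apply/infixP; exists (take x w), (drop n (drop x w)); rewrite !cat_take_drop.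
- by rewrite inE; move: aa; rewrite aE => -[->].
- have {pt} : path (fun i j => c i j == Some e) i0 (take k t).
    by apply: take_path; rewrite -aE; exact: pairwise_sorted pt.
  by elim: (take k t) (i0) => //= j r IH i /andP[-> /IH].
Qed.

Definition ramsey (k : nat) : nat := ex_minn (ramsey_bound_ex k).

Inductive tree : Type :=
| Leaf of S * seq S
| ProdNode of S * seq S & tree & tree
| IdemNode of S * seq S & tree & tree.

Definition label (t : tree) : S * seq S :=
  match t with Leaf l | ProdNode l _ _ | IdemNode l _ _ => l end.

Fixpoint height (t : tree) : nat :=
  match t with
  | Leaf _ => 0
  | ProdNode _ t1 t2 | IdemNode _ t1 t2 => (maxn (height t1) (height t2)).+1
  end.

Fixpoint well_labeled (t : tree) : Prop :=
  match t with
  | Leaf (x, w) => w = [:: x]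
  | ProdNode (x, w) t1 t2 =>
      [/\ ((label t1).1 * (label t2).1)%g = x,
          (label t1).2 ++ (label t2).2 = w,
          well_labeled t1 & well_labeled t2]
  | IdemNode (e, w) t1 t2 =>
      [/\ (label t1).1 = e /\ (label t2).1 = e,
          e \in idem,
          exists w', [/\ w = (label t1).2 ++ w' ++ (label t2).2,
            phi (label t1).2 = Some e, phi (label t2).2 = Some e
            & phi w' = Some e],
          well_labeled t1 & well_labeled t2]
  end.

Definition summary w (t : tree) : Prop := well_labeled t /\ (label t).2 = w.

Definition result (t : tree) : S := (label t).1.

End Semigroup.

Definition log2 {R : realType} (x : R) : R := (ln x / ln 2)%R.

(* Main.v *)
(* Call three consecutive factors of equal idempotent value e a triple at e, and
   let the level of e be the maximal length of a chain of idempotents going up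
   from e in the J-order. One bounds the height of summaries by induction on the
   maximal level k of the triples of w. Without triples, |w| < R(3) and a balanced
   tree of products works.

   Otherwise cut w greedily into segments whose value is strictly J-below some
   triple idempotent of level k occurring in them. By Ramsey there are fewer than
   R(3) of them, since a triple of segments would have level k + 1; if k = L(S)
   there are none, as some idempotent lies J-below each value. Without its last
   letter, a segment v is stable: its level-k triples are J-equivalent to its
   value z. At a triple u1 u2 u3 of v at e, let y be the value of the prefix
   ending with u1: it is R-equivalent to z and L-equivalent to e, which leaves at
   most |S| pairs (e, y). Two triples with the same pair enclose a word m with
   y m = y, hence m = e, so that the part of v from the u1 of the first to the
   u2 u3 of the last collapses to an idempotent node. Thus v is cut in at most
   2|S| + 1 pieces whose summaries involve words of level below k only. *)
Require Import Defs.
From mathcomp Require Import all_boot all_order all_algebra.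
From mathcomp Require Import all_classical all_reals all_analysis.
From mathcomp Require Import zify lra.
Import Order.TTheory GRing.Theory Num.Theory.

Set Implicit Arguments.
Unset Strict Implicit.
Unset Printing Implicit Defensive.

Local Notation "x ** y" := (mul1 x y) (at level 40, left associativity).

(** * Stability of finite monoids, and two facts on lists *)

Lemma monoid_stable (T : finType) (op : T -> T -> T) (u p t z q : T) :
  associative op -> left_id u op ->
  z = op (op p (op t z)) q -> exists s, z = op s (op t z).
Proof.
move=> opA op1 zE; pose I x : {set T} := finset.imset (op^~ x) (mem T).
have subI m x : I (op m x) \subset I x.
  by apply/fintype.subsetP => y /finset.imsetP[n _ ->]; rewrite opA finset.imset_f.
suff /eqP IE : I (op t z) == I z.
  have : z \in I z by apply/finset.imsetP; exists u; rewrite ?op1.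
  by rewrite -IE => /finset.imsetP[s _ zE']; exists s.
(* Right multiplication by [q] maps the left ideal of [p t z] onto that of [z], so the latter is no
   larger than that of [t z]. *)
rewrite eqEcard subI /=; apply: leq_trans (subset_leq_card (subI p _)).
apply: leq_trans (leq_imset_card (op^~ q) _); apply: subset_leq_card.
apply/fintype.subsetP => y /finset.imsetP[m _ ->].
apply/finset.imsetP; exists (op m (op p (op t z))); first exact: finset.imset_f.
by rewrite {1}zE !opA.
Qed.

Lemma shortest_prefix (T : Type) (Q : seq T -> Prop) w : Q w -> ~ Q [::] ->
  exists q b r, [/\ w = rcons q b ++ r, ~ Q q & Q (rcons q b)].
Proof.
move=> Qw Q0; elim/last_ind: w Qw => [//|w b IH Qwb].
have [/IH[q [c [r [-> nq Qq]]]]|nQ] := pselect (Q w).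
  by exists q, c, (rcons r b); rewrite rcons_cat.
by exists w, b, [::]; rewrite cats0.
Qed.

Lemma map_cat_inv (T U : Type) (f : T -> U) s a b : map f s = a ++ b ->
  exists s1 s2, [/\ s = s1 ++ s2, map f s1 = a & map f s2 = b].
Proof.
move=> E; exists (take (size a) s), (drop (size a) s).
by rewrite cat_take_drop map_take map_drop E take_size_cat // drop_size_cat.
Qed.

Section Summaries.
Variable S : finSemigroupType.
Implicit Types (x y z e f : S) (u v w : seq S).

(** * Stability, keys and chains of idempotents in the J-order *)

Lemma mul1x (a : option S) : None ** a = a. Proof. by case: a. Qed.

Lemma mulx1 (a : option S) : a ** None = a. Proof. by case: a. Qed.

Lemma mul1SS x y : Some x ** Some y = Some (x * y)%g. Proof. by []. Qed.

Lemma leJP x y :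
  reflect (exists a b, Some x = a ** Some y ** b) (leJ x y).
Proof.
apply: (iffP existsP) => [[a /existsP[b /eqP]]|[a [b /eqP]]] h.
  by exists a, b.
by exists a; apply/existsP; exists b.
Qed.

Lemma leJ_phi u v w x y : phi v = Some y -> phi (u ++ v ++ w) = Some x ->
  leJ x y.
Proof.
move=> vy; rewrite !phi_cat vy => xE; apply/leJP; exists (phi u), (phi w).
by rewrite -xE mul1A.
Qed.

Lemma stableL (t : option S) z : (exists p q, Some z = p ** (t ** Some z) ** q) ->
  exists s, Some z = s ** (t ** Some z).
Proof. by move=> [p [q]]; apply: monoid_stable (@mul1A S) mul1x. Qed.

Lemma stableR (t : option S) z : (exists p q, Some z = p ** (Some z ** t) ** q) ->
  exists s, Some z = Some z ** t ** s.
Proof.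
move=> [p [q zE]].
have opA : associative (fun a b : option S => b ** a) by move=> a b c; rewrite mul1A.
by apply: (monoid_stable (p := q) (q := p) opA mulx1); rewrite mul1A.
Qed.

Lemma phi_ex w : w <> [::] -> exists y, phi w = Some y.
Proof. by case: w => // x u _; eexists. Qed.

(** Abstracts a prefix of value [y] ending in a factor of value [e], in a stable word of value
    [z]. *)
Definition anchored z e y :=
  [/\ (e * e)%g = e, leJ e z, exists c, Some z = Some y ** c & (y * e)%g = y].

(* [t e] moves the R-class of [z] bijectively onto the R-class of [e], so
   [t e * y] lies in the maximal subgroup at [e]: this is why [#|S|] keys are
   enough for the pairs [(e, y)]. *)
Lemma anchored_key z : exists K : S -> S -> S, forall e f x y,
  anchored z e x -> anchored z f y -> K e x = K f y -> e = f /\ x = y.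
Proof.
have /choice[t tP] : forall e, exists t, (e * e)%g = e -> leJ e z ->
    (e * t)%g = t /\ exists b, Some e = Some t ** Some z ** b.
  move=> e; have [[ee ez]|ne] := pselect ((e * e)%g = e /\ leJ e z); last first.
    by exists e => ? ?; case: ne.
  have /leJP[a [b eE]] := ez.
  have [t0 t0E] : exists t, Some e ** a = Some t by case: (a) => [c|]; eexists.
  exists t0 => _ _; split.
    have : Some e ** (Some e ** a) = Some e ** a by rewrite mul1A /= ee.
    by rewrite t0E => -[].
  by exists b; rewrite -t0E -!mul1A (mul1A a) -eE /= ee.
exists (fun e y => (t e * y)%g).
(* By stability, [s] undoes left multiplication by [t e] on the right ideal of [z]. *)
have back e : (e * e)%g = e -> leJ e z -> leJ z e ->
    exists s, forall y d, Some y = Some z ** d -> Some y = s ** Some (t e * y)%g.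
  move=> ee ez /leJP[p [q zE]]; have [_ [b eE]] := tP e ee ez.
  have [|s sE] := @stableL (Some (t e)) z.
    by exists p, (b ** q); rewrite {1}zE eE !mul1A.
  exists s => y d yE; rewrite -[Some (_ * _)%g]/(Some (t e) ** Some y) yE.
  by rewrite {1}sE !mul1A.
have key e y : anchored z e y -> [/\ leJ z e, exists d, Some y = Some z ** d &
    leJ e (t e * y)%g /\ (e * (t e * y) = t e * y)%g /\ ((t e * y) * e = t e * y)%g].
  move=> [ee ez [c zE] ye].
  have ze : leJ z e.
    by apply/leJP; exists (Some y), c; rewrite zE /= ye.
  have [d yE] : exists d, Some y = Some z ** d.
    have [|d dE] := @stableR c y; last by exists d; rewrite zE.
    have : leJ y z.
      by apply: leJ_trans ez; apply/leJP; exists (Some y), None; rewrite /= ye.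
    by move=> /leJP[p [q]]; rewrite zE; exists p, q.
  split=> //; first by exists d.
  have [s sP] := back e ee ez ze; have [ete _] := tP e ee ez.
  split; last by rewrite mulgA ete -mulgA ye.
  apply: leJ_trans ez _; apply/leJP; exists s, c.
  by rewrite -(sP _ _ yE).
(* An element of [e S e] that is J-above [e] lies in the H-class of [e]. An H-class holds at most
   one idempotent, so equal keys force [e = f]. *)
have absorb e g : leJ e g -> (e * g = g)%g -> (g * e = g)%g ->
    (exists d, Some e = Some g ** d) /\ (exists d, Some e = d ** Some g).
  move=> /leJP[p [q eE]] eg ge; split.
    have [|d] := @stableR (Some g) e; first by exists p, q; rewrite /= eg.
    by rewrite /= eg; exists d.
  have [|d] := @stableL (Some g) e; first by exists p, q; rewrite /= ge.
  by rewrite /= ge; exists d.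
move=> e f x y /[dup] [[ee ez _ _]] /key[ze [d xE] [eK [eKl eKr]]].
move=> /key[_ [d' yE] [fK [fKl fKr]]] KE; rewrite -KE in fK fKl fKr.
have ef : e = f.
  have [_ [a eE]] := absorb _ _ eK eKl eKr.
  have [[b fE] _] := absorb _ _ fK fKl fKr.
  have : Some e ** Some f = Some e by rewrite eE -mul1A /= fKr.
  by rewrite {1}fE mul1A mul1SS eKl -fE => -[].
split=> //; have [s sP] := back e ee ez ze.
by apply: Some_inj; rewrite (sP _ _ xE) KE -ef -(sP _ _ yE).
Qed.

(** As [y] is L-equivalent to [e], some [s] satisfies [s y = e]; multiplying [y m = y] by it gives
    [e m = e]. *)
Lemma anchored_return z e y m : anchored z e y ->
  (y * m)%g = y -> (e * m)%g = m -> m = e.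
Proof.
move=> [ee ez [c zE] ye] ym em.
have [|s sE] := @stableL (Some y) e.
  have /leJP[p [q eE]] := ez; exists p, (c ** q).
  by rewrite /= ye eE zE !mul1A.
apply: Some_inj; rewrite -em -[LHS]/(Some e ** Some m) sE.
by rewrite /= ye -mul1A /= ym.
Qed.

(* The chain has [k.+1] elements, [e] being the smallest. *)
Definition chain_from k e := exists c : seq S,
  [/\ size c = k, all (mem (idem S)) (e :: c) & path (@ltJ S) e c].

Lemma chain_from_idem k e : chain_from k e -> (e * e)%g = e.
Proof. by case=> c [_ /= /andP[+ _] _]; rewrite inE => /eqP. Qed.

Lemma chain_from_lt k e f : (f * f)%g = f -> ltJ f e -> chain_from k e ->
  chain_from k.+1 f.
Proof.
move=> ff fe [c [sc ac pc]]; exists (e :: c).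
by split => //=; rewrite ?sc ?fe //= inE ff eqxx.
Qed.

Lemma chain_from_regJlength k e : chain_from k e -> k < regJlength S.
Proof.
move=> [c [sc ac pc]]; rewrite /regJlength; case: ex_maxnP => j _; apply.
have szc : size (e :: c) == k.+1 by rewrite /= sc.
by apply/existsP; exists (Tuple szc); apply/andP.
Qed.

(** * Words without triples, and the Ramsey function *)

Definition triple_of e u1 u2 u3 :=
  [/\ phi u1 = Some e, phi u2 = Some e & phi u3 = Some e].

Definition occurs k e w := chain_from k e /\ exists p u1 u2 u3 q : seq S,
  w = p ++ (u1 ++ u2 ++ u3) ++ q /\ triple_of e u1 u2 u3.

(** [chain_from k] holds at every idempotent of level at least [k], so [good 0] excludes all
    triples. *)
Definition good k w := forall e, ~ occurs k e w.

Lemma occurs_infix k e u w v : occurs k e w -> occurs k e (u ++ w ++ v).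
Proof.
move=> [ke [x' [u1 [u2 [u3 [y' [-> t]]]]]]]; split=> //.
by exists (u ++ x'), u1, u2, u3, (y' ++ v); rewrite !catA.
Qed.

Lemma good_infix k u w v : good k (u ++ w ++ v) -> good k w.
Proof. by move=> g e /(occurs_infix u v)/g. Qed.

Lemma good0 : forall k, good k [::].
Proof.
move=> k e [_ [[|a x] [[|b u1] [u2 [u3 [y [//= _ [+ _ _]]]]]]]]; by [].
Qed.

Lemma phi_flatten x (ss : seq (seq S)) : {in ss, forall s, s <> [::]} ->
  phi [seq odflt x (phi s) | s <- ss] = phi (flatten ss).
Proof.
elim: ss => [//|s ss IH] ne.
have [|y yE] := @phi_ex s; first by apply: ne; rewrite mem_head.
rewrite map_cons -cat1s !phi_cat yE IH // => t tss.
by apply: ne; rewrite inE tss orbT.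
Qed.

Lemma ramsey_spec k : ramsey_bound S k (ramsey S k).
Proof. by rewrite /ramsey; case: ex_minnP => m /asboolP. Qed.

Lemma ramsey_triple w : ramsey S 3 <= size w ->
  exists e (p u1 u2 u3 q : seq S), [/\ (e * e)%g = e,
    w = p ++ (u1 ++ u2 ++ u3) ++ q & triple_of e u1 u2 u3].
Proof.
move=> Rw; have [|us [e [sz inf ide]]] := @ramsey_spec 3 (take (ramsey S 3) w).
  by rewrite size_takel.
case: us sz inf => [|u1 [|u2 [|u3 [|//]]]] //= _.
rewrite cats0 => /infixP[x [y wE]] /and4P[/eqP p1 /eqP p2 /eqP p3 _].
exists e, x, u1, u2, u3, (y ++ drop (ramsey S 3) w); split => //.
  by move: ide; rewrite inE => /eqP.
by rewrite -{1}(cat_take_drop (ramsey S 3) w) wE -!catA.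
Qed.

Lemma ramsey_ge3 (x : S) : 2 < ramsey S 3.
Proof.
have [|e [a [u1 [u2 [u3 [b [_ /(congr1 size)]]]]]]] := @ramsey_triple (nseq (ramsey S 3) x).
  by rewrite size_nseq.
rewrite size_nseq !size_cat => -> [].
case: u1 => // ? ?; case: u2 => // ? ?; case: u3 => //= ? ? _ _ _.
by rewrite !addSn !addnS !ltnS.
Qed.

(** The Ramsey bound yields an idempotent among the powers of [x]. *)
Lemma idem_below (x : S) : exists2 e, (e * e)%g = e & leJ e x.
Proof.
have [|e [a [u1 [u2 [u3 [b [ee nE [p1 _ _]]]]]]]] := @ramsey_triple (nseq (ramsey S 3) x).
  by rewrite size_nseq.
exists e => //; case: u1 p1 nE => [//|y u1] p1 nE.
have yx : y = x.
  have : y \in nseq (ramsey S 3) x by rewrite nE !mem_cat mem_head orbT.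
  by rewrite mem_nseq => /andP[_ /eqP].
by apply: (@leJ_phi [::] [:: y] u1) => //; rewrite yx.
Qed.

(** * Building summaries, and balancing products of pieces *)

Definition summarizable h w := exists t : tree S,
  [/\ summary w t, phi w = Some (result t) & height t <= h].

Lemma summarizable_le h h' w : h <= h' -> summarizable h w -> summarizable h' w.
Proof. by move=> hh [t [? ? ht]]; exists t; split=> //; apply: leq_trans hh. Qed.

Lemma summarizable1 x : summarizable 0 [:: x].
Proof. by exists (Leaf (x, [:: x])). Qed.

Lemma summarizable_cat h u v : summarizable h u -> summarizable h v ->
  summarizable h.+1 (u ++ v).
Proof.
move=> [t [[wt lt] pt ht]] [s [[ws ls] ps hs]].
exists (ProdNode ((result t * result s)%g, u ++ v) t s); split.
- by split=> //=; rewrite lt ls.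
- by rewrite phi_cat pt ps.
- by rewrite /= ltnS geq_max ht hs.
Qed.

Lemma summarizable_idem h e u v w : (e * e)%g = e ->
  phi u = Some e -> phi v = Some e -> phi w = Some e ->
  summarizable h u -> summarizable h v -> summarizable h.+1 (u ++ w ++ v).
Proof.
move=> ee pu pv pw [t [[wt lt] pt ht]] [s [[ws ls] ps hs]].
have te : result t = e by apply: Some_inj; rewrite -pt.
have se : result s = e by apply: Some_inj; rewrite -ps.
exists (IdemNode (e, u ++ w ++ v) t s); split.
- split=> //=; split=> //; first by rewrite inE ee.
  by exists w; rewrite lt ls.
- by rewrite !phi_cat pu pv pw /= !ee.
- by rewrite /= ltnS geq_max ht hs.
Qed.

Definition cuttable h n w := exists ws : seq (seq S),
  [/\ flatten ws = w, size ws <= n & {in ws, forall u, summarizable h u}].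

Lemma cuttable_le h n m w : n <= m -> cuttable h n w -> cuttable h m w.
Proof. by move=> nm [ws [? sz ?]]; exists ws; split=> //; apply: leq_trans nm. Qed.

Lemma cuttable_nil h n : cuttable h n [::].
Proof. by exists [::]. Qed.

Lemma cuttable1 h w : summarizable h w -> cuttable h 1 w.
Proof.
by exists [:: w]; rewrite /= cats0; split=> // u; rewrite inE => /eqP->.
Qed.

Lemma cuttable_cat h n m u v : cuttable h n u -> cuttable h m v ->
  cuttable h (n + m) (u ++ v).
Proof.
move=> [us [<- su hu]] [vs [<- sv hv]]; exists (us ++ vs).
rewrite flatten_cat size_cat leq_add //; split=> // w.
by rewrite mem_cat => /orP[/hu|/hv].
Qed.

Lemma cuttable_letters w : cuttable 0 (size w) w.
Proof.
elim: w => [|x w IH] /=; first exact: cuttable_nil.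
by rewrite -cat1s -add1n; apply: cuttable_cat => //; apply/cuttable1/summarizable1.
Qed.

(** Halving the list of pieces gives a balanced tree; an empty half adds no node. *)
Lemma cuttable_summarizable h d w : w <> [::] -> cuttable h (2 ^ d) w ->
  summarizable (h + d) w.
Proof.
move=> w0 [ws [wE]]; subst w; elim: d ws w0 => [|d IH] ws w0.
  rewrite addn0; case: ws w0 => [//|u [|//]] _ _ hu.
  by rewrite /= cats0; apply: hu; rewrite mem_head.
rewrite expnS mul2n -addnn => sz hw.
rewrite -(cat_take_drop (2 ^ d) ws) flatten_cat.
have IH1 : flatten (take (2 ^ d) ws) <> [::] ->
    summarizable (h + d) (flatten (take (2 ^ d) ws)).
  move=> n0; apply: IH => //; first by rewrite size_take; case: ltnP.
  by move=> u /mem_take/hw.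
have IH2 : flatten (drop (2 ^ d) ws) <> [::] ->
    summarizable (h + d) (flatten (drop (2 ^ d) ws)).
  move=> n0; apply: IH => //; first by rewrite size_drop leq_subLR.
  by move=> u /mem_drop/hw.
have hS : h + d <= h + d.+1 by rewrite addnS.
have E : flatten (take (2 ^ d) ws) ++ flatten (drop (2 ^ d) ws) <> [::].
  by rewrite -flatten_cat cat_take_drop.
case: (flatten (take _ _)) IH1 E => [|a u] IH1 /= E.
  by apply: summarizable_le hS _; apply: IH2.
case: (flatten (drop _ _)) IH2 => [|b v] IH2.
  by rewrite cats0; apply: summarizable_le hS _; apply: IH1.
by rewrite addnS; apply: (@summarizable_cat _ (a :: u)); [apply: IH1|apply: IH2].
Qed.

(** * Stable words, cuts with keys, broken segments *)

Definition stable k v := forall e, occurs k e v ->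
  exists2 z, phi v = Some z & leJ e z.

(* After a prefix [p], the word [w] has a cut [l | t] around the idempotent [e],
   with key [g]. Two cuts with the same key enclose a word of value [e]. *)
Definition keyed (K : S -> S -> S) z k g p w l t q := exists e y,
  [/\ w = l ++ t ++ q, anchored z e y /\ phi (p ++ l) = Some y, K e y = g,
      phi t = Some e & exists u b, t = rcons u b /\ good k u].

Lemma keyed_shift K z k g p s w l t q : keyed K z k g (p ++ s) w l t q ->
  keyed K z k g p (s ++ w) (s ++ l) t q.
Proof.
move=> [e [y [-> [anc pl] Kg pt tg]]]; exists e, y.
by split => //; rewrite ?catA // -catA in pl *.
Qed.

(** A later cut lies in the remainder [q], which shrinks since each [t] is nonempty, so moving to
    later cuts stops. *)
Lemma keyed_last K z k g p w l t q : keyed K z k g p w l t q ->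
  exists l' t' q', keyed K z k g p w l' t' q' /\
    forall l2 t2 q2, ~ keyed K z k g (p ++ l' ++ t') q' l2 t2 q2.
Proof.
elim/ltn_ind: {q}(size q) {-2}q (erefl (size q)) l t => n IH q qn l t kq.
have [[l2 [t2 [q2 k2]]]|none] :=
    pselect (exists l2 t2 q2, keyed K z k g (p ++ l ++ t) q l2 t2 q2); last first.
  by exists l, t, q; split=> // l2 t2 q2 k2; apply: none; exists l2, t2, q2.
have [e [y [wE _ _ _ _]]] := kq.
have [e2 [y2 [qE _ _ _ [u [b [t2E _]]]]]] := k2.
have := keyed_shift k2; rewrite -catA -wE; apply: (IH (size q2)) => //.
by rewrite -qn qE t2E !size_cat size_rcons addSn addnS ltnS addnA leq_addl.
Qed.

(** A triple of [rcons q b] that missed the last letter would lie in [q]. *)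
Lemma occurs_end k q b : good k q -> ~ good k (rcons q b) ->
  exists e (x u1 u2 u : seq S), [/\ q = x ++ u1 ++ u2 ++ u, chain_from k e
    & triple_of e u1 u2 (rcons u b)].
Proof.
move=> gq; apply: contra_notP => none e [ke [x [u1 [u2 [u3 [y [qE [p1 p2 p3]]]]]]]].
case/lastP: y qE => [|y c] qE; last first.
  apply: (gq e); split=> //; exists x, u1, u2, u3, y.
  by move: qE; rewrite -!rcons_cat => /rcons_inj[->].
case/lastP: u3 p3 qE => [//|u c p3].
rewrite cats0 -!rcons_cat => /rcons_inj[qE cb]; apply: none.
by exists e, x, u1, u2, u; split=> //; rewrite cb.
Qed.


(* The value of [s] lies strictly J-below an idempotent of level [k]; the next
   triple found among such values would start a longer chain. *)
Definition broken k s := exists s0 b e x,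
  [/\ s = rcons s0 b, stable k s0, occurs k e s, phi s = Some x & ltJ x e].

(** Each segment is a shortest unstable prefix of what remains. Its value is J-below the idempotents
    of all its triples, and instability makes it strictly below one. *)
Lemma segments k w : exists ss v, [/\ w = flatten ss ++ v, stable k v
  & {in ss, forall s, broken k s}].
Proof.
elim/ltn_ind: {w}(size w) {-2}w (erefl (size w)) => n IH w wn.
have [st|nst] := pselect (stable k w); first by exists [::], w.
have [|q [b [r [wE /contrapT stq nstqb]]]] :=
    @shortest_prefix _ (fun q => ~ stable k q) w nst.
  by apply => e /good0.
have [|ss [v [rE stv bss]]] := IH (size r) _ r erefl.
  by rewrite -wn wE size_cat size_rcons ltnS leq_addl.
exists (rcons q b :: ss), v; split=> //; first by rewrite wE rE /= catA.
move=> s; rewrite inE => /orP[/eqP-> {s}|/bss//].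
have [|x xE] := @phi_ex (rcons q b); first by case: (q).
apply: contrapT => nb; apply: nstqb => e oe; exists x => //.
apply: contrapT => /negP nex; apply: nb; exists q, b, e, x; split=> //.
rewrite /ltJ nex andbT.
have [_ [p [u1 [u2 [u3 [q' [qE [p1 _ _]]]]]]]] := oe.
by apply: (@leJ_phi p u1 (u2 ++ u3 ++ q')) => //; rewrite -xE qE -!catA.
Qed.

Lemma leJ_ltJ x y z : leJ x y -> ltJ y z -> ltJ x z.
Proof.
move=> xy /andP[yz nzy]; rewrite /ltJ (leJ_trans xy yz) /=.
by apply: contra nzy => zx; exact: leJ_trans zx xy.
Qed.

Lemma broken_lt_ramsey k ss : good k.+1 (flatten ss) ->
  {in ss, forall s, broken k s} -> size ss < ramsey S 3.
Proof.
move=> gss bss; rewrite ltnNge; apply/negP => Rss.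
have [x0 _] : exists x : S, True.
  case: (ss) Rss bss => [|s ss'] Rss; last first.
    by move=> /(_ s (mem_head _ _)) [_ [b _]]; exists b.
  have [|e [p [u1 [u2 [u3 [q [_ _ [p1 _ _]]]]]]]] := @ramsey_triple [::]; first by [].
  by exists e.
have ne : {in ss, forall s, s <> [::]}.
  by move=> s /bss[s0 [b [_ [_ [-> _ _ _ _]]]]]; case: (s0).
have [|f [p [u1 [u2 [u3 [q [ff vE [p1 p2 p3]]]]]]]] :=
    @ramsey_triple [seq odflt x0 (phi s) | s <- ss]; first by rewrite size_map.
have [ssp [ss' [ssE _ /map_cat_inv[ss0 [ssq [ss'E + _]]]]]] := map_cat_inv vE.
move=> /map_cat_inv[ss1 [ss23 [ss0E s1E /map_cat_inv[ss2 [ss3 [ss23E s2E s3E]]]]]].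
have ssE' : ss = ssp ++ (ss1 ++ ss2 ++ ss3) ++ ssq by rewrite ssE ss'E ss0E ss23E.
have sub t : t \in ss1 ++ ss2 ++ ss3 -> t \in ss.
  by rewrite ssE' => ?; rewrite mem_cat mem_cat; apply/orP; right; apply/orP; left.
rewrite -s1E phi_flatten in p1; last by move=> t tt; apply/ne/sub; rewrite mem_cat tt.
rewrite -s2E phi_flatten in p2; last by move=> t tt; apply/ne/sub; rewrite !mem_cat tt orbT.
rewrite -s3E phi_flatten in p3; last by move=> t tt; apply/ne/sub; rewrite !mem_cat tt !orbT.
apply: (gss f); split; last first.
  exists (flatten ssp), (flatten ss1), (flatten ss2), (flatten ss3), (flatten ssq).
  by rewrite ssE' !flatten_cat.
case: ss1 p1 sub {s1E ss0E ssE'} => [//|s ss1] p1 sub.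
have [_ [_ [e [x [_ _ [ke _] sx xe]]]]] := bss s (sub s (mem_head _ _)).
apply: chain_from_lt ff (leJ_ltJ _ xe) ke.
by apply: (@leJ_phi [::] s (flatten ss1)).
Qed.

(** * One step of the induction on levels *)

Section OneLevel.
Variables (k h : nat).
(* The spare letter [b] pays for the last letter of the shortest prefixes that
   fail to be good or stable, so that these cost no extra height. *)
Hypothesis IHk : forall u b, good k u -> summarizable h (rcons u b).

Lemma summarizable_good u : u <> [::] -> good k u -> summarizable h u.
Proof.
case/lastP: u => [//|u b] _ g; apply: IHk.
by apply: (@good_infix k [::] _ [:: b]); rewrite cats1.
Qed.

(** Induction on the set [A] of keys that can still occur: going from the first triple to the last
    cut with its key costs at most two pieces and removes that key. The final piece is a good rest
    followed by [a]. *)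
Lemma cuttable_keyed (K : S -> S -> S) z a v :
  phi v = Some z -> stable k v ->
  (forall e f x y, anchored z e x -> anchored z f y -> K e x = K f y ->
    e = f /\ x = y) ->
  forall (A : {set S}) p r, v = p ++ r ->
    (forall g l t q, keyed K z k g p r l t q -> g \in A) ->
    cuttable h.+1 (2 * #|A|).+1 (rcons r a).
Proof.
move=> vz stv Kinj A; elim/ltn_ind: {A}#|A| {-2}A (erefl #|A|) => n IH A An.
move=> p r vE rA.
have [gr|ngr] := pselect (good k r).
  apply: (@cuttable_le _ 1) => //; apply/cuttable1/(summarizable_le (leqnSn h)).
  exact: IHk.
have [|q [b [r1 [rE /contrapT gq ngqb]]]] :=
    @shortest_prefix _ (fun q => ~ good k q) r ngr.
  by apply; exact: good0.
have [e [x [u1 [u2 [u [qE ke [p1 p2 p3]]]]]]] := occurs_end gq ngqb.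
(* [u1] becomes the left child of the idempotent node and [t] opens its middle word, while the [t2]
   of the last cut becomes the right child. *)
pose t := u2 ++ rcons u b.
have tE : t = rcons (u2 ++ u) b by rewrite /t rcons_cat.
have rE' : r = (x ++ u1) ++ t ++ r1.
  by rewrite rE qE tE !rcons_cat -!catA.
have ee := chain_from_idem ke.
have pt : phi t = Some e by rewrite phi_cat p2 p3 /= ee.
have [y yE] : exists y, phi (p ++ x ++ u1) = Some y.
  by rewrite !phi_cat p1; case: (phi p) (phi x) => [?|] [?|]; eexists.
have gt : good k (u2 ++ u).
  by apply: (@good_infix k (x ++ u1) _ [::]); rewrite cats0 -catA -qE.
have anc : anchored z e y.
  split=> //.
  - have [|z' + ez'] := stv e; last by rewrite vz => -[->].
    split=> //; exists (p ++ x), u1, u2, (rcons u b), r1; split=> //.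
    by rewrite vE rE' /t -!catA.
  - by exists (phi (t ++ r1)); rewrite -yE -phi_cat -vz vE rE' -!catA.
  - apply: Some_inj; rewrite -mul1SS -yE !phi_cat p1.
    by rewrite -!mul1A mul1SS ee.
have key : keyed K z k (K e y) p r (x ++ u1) t r1.
  by exists e, y; split=> //; exists (u2 ++ u), b.
have gA := rA _ _ _ _ key.
have Alt : #|A :\ K e y| < n by rewrite -An (cardsD1 (K e y) A) gA.
have nE : #|A| = #|A :\ K e y|.+1 by rewrite (cardsD1 (K e y) A) gA.
have rest s r2 : r = s ++ r2 ->
    (forall l t q, ~ keyed K z k (K e y) (p ++ s) r2 l t q) ->
    cuttable h.+1 (2 * #|A :\ K e y|).+1 (rcons r2 a).
  move=> rs none; apply: (IH _ Alt _ erefl (p ++ s)); first by rewrite vE rs catA.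
  move=> g l1 t1 q1 k1; rewrite in_setD1; apply/andP; split.
    by apply/eqP => gE; rewrite gE in k1; exact: none k1.
  by apply: rA; rewrite rs; exact: keyed_shift k1.
have [[l1 [t1 [q1 k1]]]|none] :=
    pselect (exists l1 t1 q1, keyed K z k (K e y) (p ++ rcons q b) r1 l1 t1 q1); last first.
  rewrite rE rcons_cat nE mulnS.
  apply: (@cuttable_le _ (1 + (2 * #|A :\ K e y|).+1)); first by rewrite !addSn.
  apply: cuttable_cat.
    exact/cuttable1/(summarizable_le (leqnSn h))/IHk.
  by apply: (rest _ _ rE) => l1 t1 q1 k1; apply: none; exists l1, t1, q1.
have [l2 [t2 [q2 [k2 last2]]]] := keyed_last k1.
have [f [y2 [r1E [anc2 y2E] KE pt2 [u' [b' [t2E gu']]]]]] := k2.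
have [fe yy] := Kinj _ _ _ _ anc2 anc KE; rewrite {f}fe {y2}yy in anc2 y2E KE pt2.
pose m := t ++ l2.
have [m0 mE] : exists m0, phi m = Some m0.
  by rewrite /m phi_cat pt; case: (phi l2) => [?|]; eexists.
(* The prefixes before [t] and before [t2] both have value [y], so [y m0 = y]. *)
have m0e : m0 = e.
  apply: (anchored_return anc).
    apply: Some_inj; rewrite -mul1SS -{1}yE -mE -phi_cat -y2E; congr phi.
    by rewrite qE /m /t !rcons_cat -!catA.
  by apply: Some_inj; rewrite -mul1SS -mE /m phi_cat pt mul1A mul1SS ee.
rewrite m0e in mE.
have -> : rcons r a = x ++ (u1 ++ m ++ t2) ++ rcons q2 a.
  by rewrite rE' r1E /m -!rcons_cat -!catA.
rewrite nE mulnS -addnS -[2]/(1 + 1) -addnA; apply: cuttable_cat.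
  have [->|x0] := pselect (x = [::]); first exact: cuttable_nil.
  apply/cuttable1/(summarizable_le (leqnSn h))/summarizable_good => //.
  by apply: (@good_infix k [::] _ (u1 ++ u2 ++ u)); rewrite /= -qE.
apply: cuttable_cat.
  apply/cuttable1/(summarizable_idem ee) => //; last by rewrite t2E; exact: IHk.
  apply: summarizable_good; first by case: (u1) p1.
  by apply: (@good_infix k x _ (u2 ++ u)); rewrite -qE.
have qE2 : r = (rcons q b ++ l2 ++ t2) ++ q2 by rewrite rE r1E -!catA.
by apply: (rest _ _ qE2) => l3 t3 q3; rewrite catA; exact: last2.
Qed.

Lemma cuttable_stable v a : stable k v ->
  cuttable h.+1 (2 * #|S|).+1 (rcons v a).
Proof.
have [->|v0] := pselect (v = [::]) => stv.
  apply: (@cuttable_le _ 1) => //; apply/cuttable1/(summarizable_le (leqnSn h)).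
  exact/IHk/good0.
have [z vz] := phi_ex v0; have [K Kinj] := anchored_key z.
rewrite -cardsT; apply: (cuttable_keyed a vz stv Kinj (p := [::])) => // *.
Qed.

Lemma cuttable_broken ss : {in ss, forall s, broken k s} ->
  cuttable h.+1 (size ss * (2 * #|S|).+1) (flatten ss).
Proof.
elim: ss => [|s ss IH] bs /=; first exact: cuttable_nil.
rewrite mulSn; apply: cuttable_cat; last first.
  by apply: IH => t tss; apply: bs; rewrite inE tss orbT.
have [|s0 [b [_ [_ [-> sts _ _ _]]]]] := bs s; first by rewrite mem_head.
exact: cuttable_stable.
Qed.

(** [n] bounds the number of broken segments plus the stable rest; it is a parameter because the top
    level has no broken segment. *)
Lemma summarizable_step n d w a : good k.+1 w ->
  (forall ss, good k.+1 (flatten ss) -> {in ss, forall s, broken k s} ->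
    size ss < n) ->
  n * (2 * #|S|).+1 <= 2 ^ d ->
  summarizable (h.+1 + d) (rcons w a).
Proof.
move=> gw few nd; apply: cuttable_summarizable; first by case: (w).
have [ss [v [wE stv bss]]] := segments k w.
have lt : size ss < n.
  by apply: few => //; apply: (@good_infix _ [::] _ v); rewrite /= -wE.
rewrite wE rcons_cat; apply: cuttable_le nd _.
apply: (@cuttable_le _ ((size ss).+1 * (2 * #|S|).+1)); first by rewrite leq_mul2r lt orbT.
rewrite mulSn addnC; apply: cuttable_cat; first exact: cuttable_broken.
exact: cuttable_stable.
Qed.
End OneLevel.

(** * The induction on levels and the total height *)

Lemma summarizable_good0 d w a : ramsey S 3 <= 2 ^ d -> good 0 w ->
  summarizable d (rcons w a).
Proof.
move=> Rd gw; rewrite -[d]add0n; apply: cuttable_summarizable; first by case: (w).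
apply: cuttable_le (cuttable_letters _).
(* A word without triples is shorter than [ramsey S 3], which leaves room for [a]. *)
rewrite size_rcons; apply: leq_trans Rd; rewrite ltnNge; apply/negP => Rw.
have [e [p [u1 [u2 [u3 [q [ee wE t]]]]]]] := ramsey_triple Rw.
apply: (gw e); split; last by exists p, u1, u2, u3, q.
by exists [::]; rewrite /= inE ee eqxx.
Qed.

Lemma summarizable_level (r s : nat) k w a :
  ramsey S 3 <= 2 ^ r -> #|S| <= 2 ^ s -> k < regJlength S -> good k w ->
  summarizable (k * (s + r + 3) + r) (rcons w a).
Proof.
move=> Rr Ss; elim: k w a => [|k IH] w a kL gw; first exact: summarizable_good0.
have -> : k.+1 * (s + r + 3) + r = (k * (s + r + 3) + r).+1 + (r + s.+2).
  by rewrite mulSn; lia.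
apply: (@summarizable_step k) gw _ _ => [u b||].
- by apply: IH; exact: ltnW.
- exact: broken_lt_ramsey.
(* [2 * #|S| + 1] is at most [4 * #|S|], hence the 2 added to [s]. *)
- rewrite expnD leq_mul // !expnS; have : 0 < #|S| by apply/card_gt0P; exists a.
  by lia.
Qed.

Lemma summarizable_all (r s : nat) w :
  ramsey S 3 <= 2 ^ r -> #|S| <= 2 ^ s -> w <> [::] ->
  summarizable (regJlength S * (s + r + 3)) w.
Proof.
move=> Rr Ss; case/lastP: w => [//|w a] _.
have [L LE] : exists L, regJlength S = L.+1.
  have [e ee _] := idem_below a.
  have /chain_from_regJlength : chain_from 0 e by exists [::]; rewrite /= inE ee eqxx.
  by case: regJlength => // L; exists L.
have topgood v : good L.+1 v.
  by move=> e [/chain_from_regJlength]; rewrite LE ltnn.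
(* The top level has no broken segment and needs no [r]; this pays for the [r] of level 0. *)
rewrite LE; have -> : L.+1 * (s + r + 3) = (L * (s + r + 3) + r).+1 + s.+2.
  by rewrite mulSn; lia.
apply: (@summarizable_step L _ _ 1) (topgood w) _ _ => [u b||].
- by apply: summarizable_level; rewrite ?LE.
- move=> [//|t ss] _ /(_ t (mem_head _ _)) [_ [_ [e [x [_ _ [ke _] _ xe]]]]].
  have [f ff fx] := idem_below x.
  by have /chain_from_regJlength := chain_from_lt ff (leJ_ltJ fx xe) ke; rewrite LE ltnn.
- by rewrite mul1n !expnS; have : 0 < #|S| by [apply/card_gt0P; exists a]; lia.
Qed.
End Summaries.

Local Open Scope ring_scope.

(** * From integer to real logarithms *)

Lemma up_log2_le (R : realType) n : (0 < n)%N ->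
  (up_log 2 n)%:R <= log2 n%:R + 1 :> R.
Proof.
move=> n0; have l2 : 0 < ln 2 :> R by rewrite ln_gt0 // ltr1n.
have [->|n1] := eqVneq n 1%N; first by rewrite /log2 up_log1 ln1 mul0r add0r.
have lt1n : (1 < n)%N by case: n n0 n1 => [|[]].
have := @up_log_gtn 2 n isT lt1n.
case: (up_log 2 n) => [|m] /= h.
  by rewrite addr_ge0 // divr_ge0 // ?ln_ge0 ?ler1n // ltW.
rewrite -natr1 lerD2r /log2 ler_pdivlMr // mulr_natl -lnXn //.
rewrite ler_ln ?posrE ?exprn_gt0 ?ltr0n //.
by rewrite -natrX ler_nat ltnW.
Qed.

Theorem theorem26 (R : realType) (S : finSemigroupType) (w : seq S)
    (hw : w <> [::]) :
  exists t : tree S,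
    [/\ summary w t,
        phi w = Some (result t)
      & (height t)%:R <=
          (regJlength S)%:R *
          (log2 (#|S|%:R : R) + 2 * log2 ((ramsey S 3)%:R : R) + 4) ].
Proof.
have [x _] := phi_ex hw; have R3 := ramsey_ge3 x.
have S0 : (0 < #|S|)%N by apply/card_gt0P; exists x.
have [t [st pt ht]] := summarizable_all (@up_logP 2 _ isT) (@up_logP 2 _ isT) hw.
exists t; split=> //; rewrite -(ler_nat R) in ht; apply: le_trans ht _.
rewrite natrM ler_wpM2l ?ler0n // !natrD.
have := up_log2_le R S0; have := up_log2_le R (ltn_trans (ltn0Sn 1) R3).
(* Rounding up both logarithms turns the 3 of each level into 5; the excess over 4 is absorbed by
   the second [log2] of [ramsey S 3], which is at least 1. *)
have : 1 <= log2 ((ramsey S 3)%:R : R).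
  rewrite /log2 ler_pdivlMr ?ln_gt0 ?ltr1n // mul1r.
  by rewrite ler_ln ?posrE ?ltr0n // ?ler_nat; apply: ltn_trans R3.
lra.
Qed.
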